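(* Let $\mathfrak g_1$ be a finite-dimensional complex Lie algebra. For any subspace $\mathfrak u$ of a subalgebra of $\mathfrak g_1$: (1) letting $V_R=\mathfrak u$ yields an Inönü–Wigner contraction of $\mathfrak g_1$ to a semi-direct algebra; (2) letting $V_N=\mathfrak u$ yields an anti-Inönü–Wigner contraction of $\mathfrak g_1$ to a nilpotent Lie algebra.
   Context: Let $V$ be the underlying vector space of $\mathfrak g_1$, $n=\dim\mathfrak g_1$, and let $u$ be a diagonal $n\times n$ matrix acting on $V$, not depending on $\varepsilon$. The subspaces $V_N$ and $V_R$ of $V$ associated with $u$ are defined by $uV_N=0$ and $uV=V_R$, and they satisfy $\mathfrak g_1=V_N\oplus V_R$ as vector spaces. Letting $V_R=\mathfrak u$ (respectively $V_N=\mathfrak u$) means choosing $u$ and the splitting $\mathfrak g_1=V_N\oplus V_R$ so that this subspace is $\mathfrak u$. A family of linear maps $U_\varepsilon$ on $V$ gives a valid Lie algebra contraction of $\mathfrak g_1$ if the limit $[\xi,\eta]_0=\lim_{\varepsilon\to0}U_\varepsilon^{-1}[U_\varepsilon\xi,U_\varepsilon\eta]$ exists for all $\xi,\eta$; the contracted Lie algebra is $V$ with bracket $[\cdot,\cdot]_0$. The contraction given by $U_{IW}=\varepsilon\,\mathrm{Id}+(1-\varepsilon)u$ is called an Inönü–Wigner contraction, and the one given by $U_{anti\text{-}IW}=\varepsilon^2\,\mathrm{Id}+\varepsilon(1-\varepsilon)u$ is called an anti-Inönü–Wigner contraction.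
   Formalization: In part (1) the subspace 𝔲 is required to be itself a subalgebra: for a subspace not closed under the bracket (e.g. span(e,f) in sl2) the limit defining the Inönü–Wigner contraction does not exist. Part (2) is for every subspace. *)

(* Defs.v *)
From HB Require Import structures.
From mathcomp Require Import all_boot all_order all_algebra.
From mathcomp Require Import complex.
From mathcomp Require Import all_classical all_reals all_analysis.

Set Implicit Arguments.
Unset Strict Implicit.
Unset Printing Implicit Defensive.

Import Order.TTheory GRing.Theory Num.Theory numFieldNormedType.Exports.

Local Open Scope ring_scope.
Local Open Scope classical_set_scope.

(* R[i], packed as a numFieldType: its topology (given by the modulus) is only
   inferred for terms whose type is the sort of a numFieldType. *)
Definition Cplx (R : realType) : numFieldType := complex R.

Section LieAlgebra.
Variables (K : fieldType) (V : vectType K).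

(* A Lie algebra with underlying vector space V. *)
Record lieAlgebra := LieAlgebra {
  lie_bracket :> V -> V -> V;
  lie_linearl : forall y, linear (lie_bracket^~ y);
  lie_linearr : forall x, linear (lie_bracket x);
  lie_alternating : forall x, lie_bracket x x = 0;
  lie_jacobi : forall x y z,
    lie_bracket x (lie_bracket y z) + lie_bracket y (lie_bracket z x)
      + lie_bracket z (lie_bracket x y) = 0
}.

Implicit Types (g : lieAlgebra) (A B S I : {vspace V}).

Definition lie_subalgebra g S : Prop :=
  forall x y, x \in S -> y \in S -> g x y \in S.

Definition lie_ideal g I : Prop := forall x y, y \in I -> g x y \in I.

Definition lie_abelian_on g I : Prop :=
  forall x y, x \in I -> y \in I -> g x y = 0.

(* g = S |>< I, where the subalgebra S acts on the vector space I, regarded as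
   an abelian ideal. *)
Definition semidirect_sum g S I : Prop :=
  [/\ lie_subalgebra g S, lie_ideal g I, lie_abelian_on g I,
      (S + I)%VS = fullv & (S :&: I)%VS = 0%VS].

(* [A, B]; by bilinearity, brackets of basis vectors suffice. *)
Definition lie_product g A B : {vspace V} :=
  <<[seq g x y | x <- vbasis A, y <- vbasis B]>>%VS.

Fixpoint lower_central g k : {vspace V} :=
  if k is k'.+1 then lie_product g fullv (lower_central g k') else fullv.

Definition lie_nilpotent g : Prop := exists k, lower_central g k = 0%VS.

Definition diagonal_in_some_basis (u : 'End(V)) : Prop :=
  exists (b : (\dim {:V}).-tuple V) (d : 'rV[K]_(\dim {:V})),
    basis_of {:V} b /\ u = passmx.hommx b b (diag_mx d).

Definition V_N (u : 'End(V)) : {vspace V} := lker u.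

Definition V_R (u : 'End(V)) : {vspace V} := limg u.

Definition U_IW (u : 'End(V)) (e : K) : 'End(V) := e *: \1%VF + (1 - e) *: u.

Definition U_anti_IW (u : 'End(V)) (e : K) : 'End(V) :=
  e ^+ 2 *: \1%VF + (e * (1 - e)) *: u.

End LieAlgebra.

Section Contraction.
Variables (R : realType) (V : vectType (Cplx R)).

(* An abstract vectType carries no topology; convergence in V is convergence of
   the coordinate vectors in the canonical basis. *)
Definition converges_at0 (F : Cplx R -> V) (l : V) : Prop :=
  passmx.rVof (vbasis {:V}) (F e) @[e --> (0 : Cplx R)^'] --> passmx.rVof (vbasis {:V}) l.

(* (f^-1)%VF is the inverse of f only when f is invertible, so invertibility
   of U e for small e != 0 is required explicitly. *)
Definition lie_contraction (g1 : lieAlgebra V) (U : Cplx R -> 'End(V))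
    (g0 : lieAlgebra V) : Prop :=
  (\forall e \near (0 : Cplx R)^', lker (U e) = 0%VS) /\
  (forall x y, converges_at0 (fun e => (U e)^-1%VF (g1 (U e x) (U e y)))
                             (g0 x y)).

End Contraction.

(* Main.v *)
(** Let [v] be the group inverse of the diagonal map [u] (invert the nonzero
    eigenvalues, keep the zeros) and [p = 1 - u v] the projection onto [V_N]
    along [V_R].  The contracted brackets are explicit:
      [[x, y]_IW = v [u x, u y] + p ([u x, p y] + [p x, u y])],
      [[x, y]_anti = p [u x, u y]],
    the first one needing [V_R] to be a subalgebra.  In the second one every
    double bracket vanishes since [u p = 0].  For the first one,
    [u [x, y]_IW = [u x, u y]], and [V_R] acts on [V / V_R], so that its Jacobi
    identity reduces to four instances of that of [g1].  In an eigenbasis of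
    [u], contraction multiplies each structure constant by a scalar function of
    [e], whose limit at [0] is elementary. *)
Require Import Defs.
From mathcomp Require Import all_boot all_order all_algebra.
From mathcomp Require Import ring complex.
From mathcomp Require Import all_classical all_reals all_analysis.

Set Implicit Arguments.
Unset Strict Implicit.
Unset Printing Implicit Defensive.

Import Order.TTheory GRing.Theory Num.Theory numFieldNormedType.Exports.
Import passmx.

Local Open Scope ring_scope.
Local Open Scope classical_set_scope.

(** * Bilinearity and antisymmetry of the bracket *)

Section Bracket.
Variables (K : fieldType) (V : vectType K) (g : lieAlgebra V).

Lemma lie_addl x y z : g (x + y) z = g x z + g y z.
Proof. by have := lie_linearl g z 1 x y; rewrite !scale1r. Qed.

Lemma lie_addr x y z : g x (y + z) = g x y + g x z.
Proof. by have := lie_linearr g x 1 y z; rewrite !scale1r. Qed.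

Lemma lie0l y : g 0 y = 0.
Proof. by apply: (@addrI _ (g 0 y)); rewrite -lie_addl !addr0. Qed.

Lemma lie0r x : g x 0 = 0.
Proof. by apply: (@addrI _ (g x 0)); rewrite -lie_addr !addr0. Qed.

Lemma lie_scalel a x y : g (a *: x) y = a *: g x y.
Proof. by have := lie_linearl g y a x 0; rewrite lie0l !addr0. Qed.

Lemma lie_scaler a x y : g x (a *: y) = a *: g x y.
Proof. by have := lie_linearr g x a y 0; rewrite lie0r !addr0. Qed.

Lemma lie_suml (I : Type) (r : seq I) (F : I -> V) y :
  g (\sum_(i <- r) F i) y = \sum_(i <- r) g (F i) y.
Proof. by elim/big_rec2: _ => [|i _ x _ <-]; rewrite ?lie0l ?lie_addl. Qed.

Lemma lie_sumr (I : Type) (r : seq I) (F : I -> V) x :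
  g x (\sum_(i <- r) F i) = \sum_(i <- r) g x (F i).
Proof. by elim/big_rec2: _ => [|i _ y _ <-]; rewrite ?lie0r ?lie_addr. Qed.

Lemma lie_anticomm x y : g x y = - g y x.
Proof.
apply/eqP; rewrite -addr_eq0; have := lie_alternating g (x + y).
by rewrite lie_addl !lie_addr !lie_alternating add0r addr0 => ->.
Qed.

End Bracket.

(** * Coordinates in a basis and diagonal maps *)

Section Basis.
Variables (K : fieldType) (V : vectType K) (b : (\dim {:V}).-tuple V).
Hypothesis bB : basis_of {:V} b.

Lemma coord_fullv v : v = \sum_i coord b i v *: b`_i.
Proof. by apply: coord_basis bB _; rewrite memvf. Qed.

Lemma coord_inj x y : (forall i, coord b i x = coord b i y) -> x = y.
Proof.
move=> eqc; rewrite (coord_fullv x) (coord_fullv y).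
by apply: eq_bigr => i _; rewrite eqc.
Qed.

Lemma lfun_ext_basis (W : vectType K) (f f' : 'Hom(V, W)) :
  (forall i : 'I_(\dim {:V}), f b`_i = f' b`_i) -> f = f'.
Proof.
move=> eqf; apply/lfunP => v; rewrite (coord_fullv v) !linear_sum.
by apply: eq_bigr => i _; rewrite !linearZ /= eqf.
Qed.

Lemma hommx_diag (d : 'rV[K]_(\dim {:V})) (i : 'I_(\dim {:V})) :
  hommx b b (diag_mx d) b`_i = d 0 i *: b`_i.
Proof.
rewrite hommxE // rVofE ?(basis_free bB) // -rowE row_diag_mx.
by rewrite linearZ /= vecof_delta.
Qed.

Lemma coord_hommx_diag (d : 'rV[K]_(\dim {:V})) k x :
  coord b k (hommx b b (diag_mx d) x) = d 0 k * coord b k x.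
Proof. by rewrite hommxE // (coord_vecof bB) mul_mx_diag !mxE mulrC. Qed.

Lemma diagonal_of_eigenbasis (u : 'End(V)) (d : 'I_(\dim {:V}) -> K) :
  (forall i : 'I_(\dim {:V}), u b`_i = d i *: b`_i) -> diagonal_in_some_basis u.
Proof.
move=> ub; exists b, (\row_i d i); split=> //.
by apply: lfun_ext_basis => i; rewrite hommx_diag mxE ub.
Qed.

End Basis.

(** * Diagonal maps with prescribed image or kernel *)

Section Diagonal.
Variables (K : fieldType) (V : vectType K).

Lemma diagonal_two_eigenspaces (u : 'End(V)) (S T : {vspace V}) (a c : K) :
  (S + T)%VS = fullv -> (S :&: T)%VS = 0%VS ->
  {in S, forall v, u v = a *: v} -> {in T, forall v, u v = c *: v} ->
  diagonal_in_some_basis u.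
Proof.
move=> STf ST0 uS uT.
have dST : directv (S + T) by apply/directv_addP.
have sz : size (vbasis S ++ vbasis T) == \dim {:V}.
  by rewrite size_cat !size_tuple -STf (directvP dST).
pose b := Tuple sz.
have bB : basis_of {:V} b.
  by have := cat_basis dST (vbasisP S) (vbasisP T); rewrite STf.
(* The first [size (vbasis S)] vectors of [b] span [S], the others [T], so the index decides the
   eigenvalue. *)
apply: (diagonal_of_eigenbasis bB
  (d := fun i => if (i < size (vbasis S))%N then a else c)) => i.
rewrite /= nth_cat; case: ltnP => lti.
  by apply: uS; apply: vbasis_mem; rewrite mem_nth.
apply: uT; apply: vbasis_mem; rewrite mem_nth // ltn_subLR //.
by rewrite -size_cat (eqP sz).
Qed.

Lemma projv_compl0 (S : {vspace V}) v : v \in (S^C)%VS -> projv S v = 0.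
Proof. by rewrite -lker_proj memv_ker => /eqP. Qed.

(** The projection onto [S] along a complement has eigenvalue 1 on [S] and 0 on the complement. *)
Lemma exists_diagonal_V_R (S : {vspace V}) :
  exists u : 'End(V), diagonal_in_some_basis u /\ V_R u = S.
Proof.
exists (projv S); split; last exact: limg_proj.
apply: (@diagonal_two_eigenspaces _ S (S^C)%VS 1 0) => [||v|v vS].
- exact: addv_complf.
- exact: capv_compl.
- by rewrite scale1r; apply: projv_id.
- by rewrite scale0r projv_compl0.
Qed.

(** The complementary projection [1 - projv S] serves. *)
Lemma exists_diagonal_V_N (S : {vspace V}) :
  exists u : 'End(V), diagonal_in_some_basis u /\ V_N u = S.
Proof.
have uE v : (\1 - projv S)%VF v = v - projv S v by rewrite !lfun_simp.
exists (\1 - projv S)%VF; split.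
  apply: (@diagonal_two_eigenspaces _ S (S^C)%VS 0 1) => [||v vS|v vS].
  - exact: addv_complf.
  - exact: capv_compl.
  - by rewrite uE projv_id // subrr scale0r.
  - by rewrite uE projv_compl0 // subr0 scale1r.
apply/vspaceP => v; rewrite memv_ker uE subr_eq0.
by apply/eqP/idP => [->|/projv_id->//]; apply: memv_proj.
Qed.

End Diagonal.

(** * The two contracted Lie algebras and their structure *)

Section GroupInverse.
Variables (K : fieldType) (V : vectType K) (g : lieAlgebra V).
Variables u v : 'End(V).
Hypotheses (uvu : forall x, u (v (u x)) = u x)
  (vuv : forall x, v (u (v x)) = v x) (uv : forall x, u (v x) = v (u x)).

Definition ker_proj : 'End(V) := (\1 - (u \o v))%VF.
Local Notation p := ker_proj.

Lemma ker_projE x : p x = x - u (v x).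
Proof. by rewrite /ker_proj !lfun_simp. Qed.

Lemma img_ker_proj x : u (p x) = 0.
Proof. by rewrite ker_projE linearB /= uv uvu subrr. Qed.

Lemma ginv_ker_proj x : v (p x) = 0.
Proof. by rewrite ker_projE linearB /= vuv subrr. Qed.

Lemma ker_proj_img x : p (u x) = 0.
Proof. by rewrite ker_projE uvu subrr. Qed.

Lemma ker_proj_ginv x : p (v x) = 0.
Proof. by rewrite ker_projE uv vuv subrr. Qed.

Lemma ker_projK x : p (p x) = p x.
Proof. by rewrite ker_projE ginv_ker_proj linear0 subr0. Qed.

Lemma mem_V_N x : (x \in V_N u) = (p x == x).
Proof.
rewrite memv_ker; apply/eqP/eqP => [ux0|<-]; last exact: img_ker_proj.
by rewrite ker_projE uv ux0 linear0 subr0.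
Qed.

Lemma mem_V_R x : (x \in V_R u) = (p x == 0).
Proof.
apply/memv_imgP/eqP => [[y _ ->]|]; first exact: ker_proj_img.
by rewrite ker_projE => /subr0_eq ->; exists (v x); rewrite ?memvf.
Qed.

Definition anti_IW_bracket x y := p (g (u x) (u y)).

Lemma anti_IW_linearl y : linear (anti_IW_bracket^~ y).
Proof.
by move=> a x x'; rewrite /anti_IW_bracket !(linearP, lie_linearl).
Qed.

Lemma anti_IW_linearr x : linear (anti_IW_bracket x).
Proof.
by move=> a y y'; rewrite /anti_IW_bracket !(linearP, lie_linearr).
Qed.

Lemma anti_IW_alternating x : anti_IW_bracket x x = 0.
Proof. by rewrite /anti_IW_bracket lie_alternating linear0. Qed.

Lemma anti_IW_bracket2 x y z : anti_IW_bracket x (anti_IW_bracket y z) = 0.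
Proof. by rewrite /anti_IW_bracket img_ker_proj lie0r linear0. Qed.

Lemma anti_IW_jacobi x y z :
  anti_IW_bracket x (anti_IW_bracket y z)
    + anti_IW_bracket y (anti_IW_bracket z x)
    + anti_IW_bracket z (anti_IW_bracket x y) = 0.
Proof. by rewrite !anti_IW_bracket2 !addr0. Qed.

Definition anti_IW_algebra : lieAlgebra V :=
  LieAlgebra anti_IW_linearl anti_IW_linearr anti_IW_alternating
    anti_IW_jacobi.

Lemma lie_product_sub (g' : lieAlgebra V) (A B C : {vspace V}) :
  (forall x y, x \in A -> y \in B -> g' x y \in C) ->
  (lie_product g' A B <= C)%VS.
Proof.
move=> gABC; apply/span_subvP => z /allpairsP[[x y] /= [xA yB ->]].
by apply: gABC; apply: vbasis_mem.
Qed.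

(** All brackets lie in [V_N u], which is central, so the nilpotency class is at most two. *)
Lemma anti_IW_nilpotent : lie_nilpotent anti_IW_algebra.
Proof.
exists 2; apply/eqP; rewrite -subv0 /=; apply: lie_product_sub => x y _ yL.
have : y \in lker u.
  apply: subvP yL; apply: lie_product_sub => {}x {}y _ _.
  by rewrite memv_ker; apply/eqP; apply: img_ker_proj.
rewrite memv_ker memv0 => /eqP uy0.
by rewrite /= /anti_IW_bracket uy0 lie0r linear0.
Qed.

Hypothesis V_R_subalg : lie_subalgebra g (V_R u).

Lemma ker_proj_bracket x y : p (g (u x) (u y)) = 0.
Proof. by apply/eqP; rewrite -mem_V_R V_R_subalg ?memv_img ?memvf. Qed.

Definition IW_bracket x y :=
  v (g (u x) (u y)) + p (g (u x) (p y) + g (p x) (u y)).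

Lemma IW_linearl y : linear (IW_bracket^~ y).
Proof.
move=> a x x'; rewrite /IW_bracket [u _]linearP [p (a *: _ + _)]linearP /=.
rewrite !lie_linearl [X in p X]addrACA -scalerDr 2!linearP /=.
by rewrite addrACA scalerDr.
Qed.

Lemma IW_linearr x : linear (IW_bracket x).
Proof.
move=> a y y'; rewrite /IW_bracket [u (a *: _ + _)]linearP.
rewrite [p (a *: _ + _)]linearP /= !lie_linearr.
rewrite [X in p X]addrACA -scalerDr 2!linearP /=.
by rewrite addrACA scalerDr.
Qed.

Lemma IW_alternating x : IW_bracket x x = 0.
Proof.
rewrite /IW_bracket (lie_anticomm g (u x) (p x)) addNr !linear0 addr0.
by rewrite lie_alternating linear0.
Qed.

(** [V_R] contains [g (u x) (u y)], and [u v] is the identity there. Thus [u] is a homomorphism from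
    the contracted bracket to [g]. *)
Lemma img_IW_bracket x y : u (IW_bracket x y) = g (u x) (u y).
Proof.
rewrite /IW_bracket linearD /= img_ker_proj addr0.
by have /eqP := ker_proj_bracket x y; rewrite ker_projE subr_eq0 => /eqP.
Qed.

Lemma ker_proj_IW_bracket x y :
  p (IW_bracket x y) = p (g (u x) (p y) + g (p x) (u y)).
Proof. by rewrite /IW_bracket linearD /= ker_proj_ginv add0r ker_projK. Qed.

(* [V_R] being a subalgebra, it acts on the quotient [V / V_R]. *)
Lemma ker_proj_bracket_ker_proj x y : p (g (u x) (p y)) = p (g (u x) y).
Proof.
rewrite [X in g _ X]ker_projE lie_addr linearD /= -scaleN1r lie_scaler.
by rewrite linearZ /= ker_proj_bracket scaler0 addr0.
Qed.

(** The inner [p] is absorbed by [ker_proj_bracket_ker_proj]. Only double brackets of [g] remain,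
    with [u] on all three arguments or [p] on exactly one, ready for the Jacobi identity of [g]. *)
Lemma IW_bracket2 x y z : IW_bracket x (IW_bracket y z) =
  v (g (u x) (g (u y) (u z))) + p (g (u x) (g (u y) (p z))
    + g (u x) (g (p y) (u z)) + g (p x) (g (u y) (u z))).
Proof.
rewrite {1}/IW_bracket img_IW_bracket ker_proj_IW_bracket; congr (_ + _).
by rewrite [LHS]linearD /= ker_proj_bracket_ker_proj -linearD /= lie_addr.
Qed.

Lemma IW_jacobi x y z :
  IW_bracket x (IW_bracket y z) + IW_bracket y (IW_bracket z x)
    + IW_bracket z (IW_bracket x y) = 0.
Proof.
(* Separate the [v] terms from the [p] terms; the former add up to the Jacobi identity at [u x],
   [u y], [u z]. *)
rewrite !IW_bracket2 [LHS](AC (2*2*2) ((1*3*5)*(2*4*6))) /= -!linearD /=.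
rewrite lie_jacobi linear0 add0r.
set a1 := g (u x) (g (u y) (p z)); set a2 := g (u x) (g (p y) (u z)).
set a3 := g (p x) _; set b1 := g (u y) _; set b2 := g (u y) _.
set b3 := g (p y) _; set c1 := g (u z) _; set c2 := g (u z) _.
set c3 := g (p z) _.
(* Group the nine terms by the argument that carries [p]: first [z], then [y], then [x]. Each group
   is a Jacobi sum of [g]. *)
have -> : a1 + a2 + a3 + (b1 + b2 + b3) + (c1 + c2 + c3) =
    (a1 + b2 + c3) + (a2 + b3 + c1) + (a3 + b1 + c2).
  by rewrite [LHS](AC (3*3*3) ((1*5*9)*(2*6*7)*(3*4*8))).
by rewrite !lie_jacobi !addr0 linear0.
Qed.

Definition IW_algebra : lieAlgebra V :=
  LieAlgebra IW_linearl IW_linearr IW_alternating IW_jacobi.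

(** Between elements of [V_R] only the [v] term of the bracket survives; with one argument in [V_N]
    only the [p] term does, and with both in [V_N] neither. The splitting is [x = u (v x) + p x]. *)
Lemma IW_semidirect : semidirect_sum IW_algebra (V_R u) (V_N u).
Proof.
split.
- move=> x y; rewrite !mem_V_R => /eqP px0 /eqP py0.
  by rewrite ker_proj_IW_bracket px0 py0 lie0l lie0r addr0 linear0.
- move=> x y /[dup] + yN; rewrite memv_ker => /eqP uy0.
  rewrite mem_V_N ker_proj_IW_bracket /= /IW_bracket uy0.
  by rewrite !lie0r linear0 add0r.
- move=> x y; rewrite !memv_ker /= /IW_bracket => /eqP-> /eqP->.
  by rewrite !lie0l lie0r addr0 !linear0 addr0.
- apply/eqP; rewrite eqEsubv subvf; apply/subvP => x _; apply/memv_addP.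
  exists (u (v x)); first by rewrite memv_img ?memvf.
  exists (p x); last by rewrite ker_projE addrC subrK.
  by rewrite memv_ker img_ker_proj.
- apply/eqP; rewrite -subv0; apply/subvP => x.
  by rewrite memv_cap mem_V_R mem_V_N memv0 => /andP[/eqP-> /eqP<-].
Qed.

End GroupInverse.

(** * Limits in [V] and contraction by simultaneously diagonal maps *)

Section Limits.
Variables (R : realType) (V : vectType (Cplx R)).
Implicit Types (F : Cplx R -> V) (l : V) (f : Cplx R -> Cplx R).

Lemma converges_at0_sum (I : Type) (r : seq I) (F : I -> Cplx R -> V)
    (l : I -> V) :
  (forall i, converges_at0 (F i) (l i)) ->
  converges_at0 (fun e => \sum_(i <- r) F i e) (\sum_(i <- r) l i).
Proof.
move=> cvgF; elim: r => [|i r IHr].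
  under eq_fun do rewrite big_nil; rewrite big_nil; exact: cvg_cst.
rewrite /converges_at0 big_cons linearD /=.
under eq_fun do rewrite big_cons linearD /=.
by apply: cvgD; [apply: cvgF|apply: IHr].
Qed.

Lemma converges_at0Zl f (a : Cplx R) l :
  f e @[e --> (0 : Cplx R)^'] --> a ->
  converges_at0 (fun e => f e *: l) (a *: l).
Proof.
move=> cvgf; rewrite /converges_at0 linearZ /=.
under eq_fun do rewrite linearZ /=.
exact: cvgZr_tmp.
Qed.

Lemma near_converges_at0 F F' l :
  (\forall e \near (0 : Cplx R)^', F e = F' e) ->
  converges_at0 F l -> converges_at0 F' l.
Proof.
move=> eqF cvgF; apply: cvg_trans cvgF; apply: near_eq_cvg.
by near=> e; congr rVof; near: e.
Unshelve. all: by end_near. Qed.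

Variables (b : (\dim {:V}).-tuple V) (g1 g0 : lieAlgebra V).
Hypothesis bB : basis_of {:V} b.

(* In an eigenbasis of all the [U e], contraction multiplies each structure
   constant [c_ij^k] by [w_i w_j / w_k], where the [w_i] are the eigenvalues. *)
Lemma lie_contraction_diagonal (U : Cplx R -> 'End(V))
    (w : 'I_(\dim {:V}) -> Cplx R -> Cplx R) :
  (forall e (i : 'I_(\dim {:V})), U e b`_i = w i e *: b`_i) ->
  (forall i, \forall e \near (0 : Cplx R)^', w i e != 0) ->
  (forall i j k : 'I_(\dim {:V}),
    coord b k (g1 b`_i b`_j) * (w i e * w j e / w k e)
      @[e --> (0 : Cplx R)^'] --> coord b k (g0 b`_i b`_j)) ->
  lie_contraction g1 U g0.
Proof.
move=> Ub w_neq0 cvgw.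
have Uexp e x : U e x = \sum_i (coord b i x * w i e) *: b`_i.
  rewrite {1}(coord_fullv bB x) linear_sum; apply: eq_bigr => i _.
  by rewrite linearZ /= Ub scalerA.
have w_near : \forall e \near (0 : Cplx R)^', forall i, w i e != 0.
  exact: filter_forall.
have Uinj e : (forall i, w i e != 0) -> lker (U e) == 0%VS.
  move=> we_neq0; rewrite -subv0; apply/subvP => x.
  rewrite memv_ker memv0 => /eqP Ux0.
  rewrite (coord_fullv bB x) big1 // => i _.
  have := coord_sum_free (fun i => coord b i x * w i e) i (basis_free bB).
  rewrite -Uexp Ux0 linear0 => /esym/eqP.
  by rewrite mulf_eq0 (negPf (we_neq0 i)) orbF => /eqP->; rewrite scale0r.
split; first by apply: filterS w_near => e /Uinj/eqP.
move=> x y.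
have -> : g0 x y = \sum_i \sum_j \sum_k
    (coord b i x * coord b j y * coord b k (g0 b`_i b`_j)) *: b`_k.
  rewrite {1}(coord_fullv bB x) lie_suml; apply: eq_bigr => i _.
  rewrite {1}(coord_fullv bB y) lie_sumr; apply: eq_bigr => j _.
  rewrite lie_scalel lie_scaler scalerA {1}(coord_fullv bB (g0 _ _)).
  by rewrite scaler_sumr; apply: eq_bigr => k _; rewrite scalerA.
pose F e : V := \sum_i \sum_j \sum_k (coord b i x * coord b j y *
  (coord b k (g1 b`_i b`_j) * (w i e * w j e / w k e))) *: b`_k.
(* The contracted bracket agrees with [F] only where every [w i e] is nonzero, hence near 0. *)
apply: (@near_converges_at0 F); last first.
  apply: converges_at0_sum => i; apply: converges_at0_sum => j.
  apply: converges_at0_sum => k; apply: converges_at0Zl.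
  exact: cvgMl_tmp.
apply: filterS w_near => e we_neq0.
have Vb (k : 'I_(\dim {:V})) : ((U e)^-1)%VF b`_k = (w k e)^-1 *: b`_k.
  rewrite -[in LHS](scale1r b`_k) -(mulVf (we_neq0 k)) -scalerA -Ub.
  by rewrite linearZ /= lker0_lfunK ?Uinj.
rewrite !Uexp lie_suml linear_sum; apply: eq_bigr => i _.
rewrite lie_sumr linear_sum; apply: eq_bigr => j _.
rewrite lie_scalel lie_scaler scalerA (coord_fullv bB (g1 b`_i b`_j)).
rewrite linearZ linear_sum /= scaler_sumr; apply: eq_bigr => k _.
rewrite linearZ /= Vb !scalerA -(coord_fullv bB); congr (_ *: _); ring.
Qed.

End Limits.

(** * The group inverse and both brackets in an eigenbasis *)

Section DiagonalGroupInverse.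
Variables (K : fieldType) (V : vectType K) (g : lieAlgebra V).
Variables (b : (\dim {:V}).-tuple V) (d : 'rV[K]_(\dim {:V})).
Hypothesis bB : basis_of {:V} b.

Local Notation u := (hommx b b (diag_mx d)).
Local Notation v := (hommx b b (diag_mx (map_mx GRing.inv d))).
Local Notation p := (ker_proj u v).

Let coord_u k x : coord b k (u x) = d 0 k * coord b k x.
Proof. exact: coord_hommx_diag. Qed.

Let coord_v k x : coord b k (v x) = (d 0 k)^-1 * coord b k x.
Proof. by rewrite coord_hommx_diag // mxE. Qed.

(** This includes [a = 0], where [0^-1 = 0]; hence inverting every entry of [d] gives the group
    inverse. *)
Let mulKVKf (a c : K) : a * (a^-1 * (a * c)) = a * c.
Proof. by have [->|a0] := eqVneq a 0; rewrite ?mul0r // mulKf. Qed.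

Lemma diag_uvu x : u (v (u x)) = u x.
Proof.
by apply: (coord_inj bB) => k; rewrite !(coord_u, coord_v) mulKVKf.
Qed.

Lemma diag_vuv x : v (u (v x)) = v x.
Proof.
apply: (coord_inj bB) => k; rewrite !(coord_u, coord_v).
by rewrite -{2}[d 0 k]invrK mulKVKf.
Qed.

Lemma diag_uv x : u (v x) = v (u x).
Proof. by apply: (coord_inj bB) => k; rewrite !(coord_u, coord_v) mulrCA. Qed.

(* [1 - a / a] is [1] if [a = 0] and [0] otherwise, as [0 / 0 = 0]. *)
Lemma coord_diag_ker_proj k x :
  coord b k (p x) = (1 - d 0 k / d 0 k) * coord b k x.
Proof. by rewrite ker_projE linearB /= coord_u coord_v; ring. Qed.

Let pb (i : 'I_(\dim {:V})) : p b`_i = (1 - d 0 i / d 0 i) *: b`_i.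
Proof.
apply: (coord_inj bB) => k; rewrite coord_diag_ker_proj linearZ /=.
rewrite coord_free ?(basis_free bB) //.
by case: eqVneq => [->|_]; rewrite ?mulr0.
Qed.

Lemma coord_bracket_diag (i j k : 'I_(\dim {:V})) :
  coord b k (g (u b`_i) (u b`_j)) = d 0 i * d 0 j * coord b k (g b`_i b`_j).
Proof.
by rewrite !hommx_diag // lie_scalel lie_scaler !linearZ /= mulrA.
Qed.

Lemma coord_anti_IW_bracket (i j k : 'I_(\dim {:V})) :
  coord b k (anti_IW_bracket g u v b`_i b`_j) =
  coord b k (g b`_i b`_j) * ((1 - d 0 k / d 0 k) * (d 0 i * d 0 j)).
Proof.
by rewrite coord_diag_ker_proj coord_bracket_diag mulrA mulrC.
Qed.

Lemma coord_IW_bracket (i j k : 'I_(\dim {:V})) :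
  coord b k (IW_bracket g u v b`_i b`_j) =
  coord b k (g b`_i b`_j) * (d 0 i * d 0 j / d 0 k + (1 - d 0 k / d 0 k) *
    (d 0 i * (1 - d 0 j / d 0 j) + (1 - d 0 i / d 0 i) * d 0 j)).
Proof.
rewrite /IW_bracket linearD /= coord_v coord_diag_ker_proj coord_bracket_diag.
rewrite linearD /= !pb !hommx_diag // !lie_scalel !lie_scaler !linearZ /=.
by set c := coord b k _; ring.
Qed.

(** Here [b_i] and [b_j] lie in the subalgebra [V_R], hence so does their bracket, whereas [b_k]
    lies in [V_N]. This excludes the structure constants whose contraction factor would diverge. *)
Lemma structure_constant_eq0 (i j k : 'I_(\dim {:V})) :
  lie_subalgebra g (V_R u) ->
  d 0 i != 0 -> d 0 j != 0 -> d 0 k = 0 -> coord b k (g b`_i b`_j) = 0.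
Proof.
move=> subalg di0 dj0 dk0.
have /(congr1 (coord b k)) := ker_proj_bracket diag_uvu subalg b`_i b`_j.
rewrite coord_diag_ker_proj dk0 mul0r subr0 mul1r coord_bracket_diag linear0.
by move/eqP; rewrite !mulf_eq0 (negPf di0) (negPf dj0) => /eqP.
Qed.

Lemma U_IW_diag e (i : 'I_(\dim {:V})) :
  U_IW u e b`_i = (e + (1 - e) * d 0 i) *: b`_i.
Proof.
rewrite /U_IW add_lfunE !scale_lfunE id_lfunE hommx_diag //.
by rewrite scalerA -scalerDl.
Qed.

(** [U_anti_IW u e] is [e] times [U_IW u e]. *)
Lemma U_anti_IW_diag e (i : 'I_(\dim {:V})) :
  U_anti_IW u e b`_i = (e * (e + (1 - e) * d 0 i)) *: b`_i.
Proof.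
rewrite /U_anti_IW add_lfunE !scale_lfunE id_lfunE hommx_diag //.
rewrite scalerA -scalerDl; congr (_ *: _).
by rewrite expr2 [RHS]mulrDr mulrA.
Qed.

End DiagonalGroupInverse.

(** * Limits of the scalar factors *)

Section Eigenvalue.
Variable K : numFieldType.
Implicit Types a : K.
Local Notation w a e := (e + (1 - e) * a).

Lemma cvg_eigenvalue a : w a e @[e --> (0 : K)^'] --> a.
Proof.
have -> : (fun e : K => w a e) = (fun e => a + e * (1 - a)).
  by apply/funext => e; rewrite mulrBl mulrBr mul1r mulr1 addrCA.
rewrite -[X in _ --> X]addr0 -[X in _ --> _ + X](mul0r (1 - a)).
by apply: cvgD; [exact: cvg_cst|apply: cvgMr_tmp; exact: nbhs_dnbhs].
Qed.

(** For [a = 0] the eigenvalue is [e] itself; otherwise its limit [a] is nonzero. *)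
Lemma eigenvalue_neq0 a : \forall e \near (0 : K)^', w a e != 0.
Proof.
have [a0|a0] := eqVneq a 0; last exact: (cvgr_neq0 _ (@cvg_eigenvalue a) a0).
by apply: filterS (nbhs_dnbhs_neq _) => e; rewrite a0 mulr0 addr0.
Qed.

(** The limit is the eigenvalue of [p]: the quotient is [e / e] if [a = 0], and otherwise tends to
    [0 / a]. *)
Lemma cvg_div_eigenvalue a : e / w a e @[e --> (0 : K)^'] --> 1 - a / a.
Proof.
have [a0|a0] := eqVneq a 0.
  rewrite a0 mul0r subr0; apply: cvg_near_cst.
  apply: filterS (nbhs_dnbhs_neq _) => e e0.
  by rewrite mulr0 addr0 divff.
rewrite divff // subrr -[X in _ --> X](mul0r a^-1).
by apply: cvgM; [exact: nbhs_dnbhs|exact: (cvgV a0 (@cvg_eigenvalue a))].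
Qed.

(* In the excluded case the quotient behaves like [a1 * a2 / e]. *)
Lemma cvg_IW_factor a1 a2 a3 : [\/ a1 = 0, a2 = 0 | a3 != 0] ->
  w a1 e * w a2 e / w a3 e @[e --> (0 : K)^'] -->
  a1 * a2 / a3 + (1 - a3 / a3) * (a1 * (1 - a2 / a2) + (1 - a1 / a1) * a2).
Proof.
have [->|a3_neq0] := eqVneq a3 0; last first.
  move=> _; rewrite divff // subrr mul0r addr0.
  apply: cvgM; last exact: (cvgV a3_neq0 (@cvg_eigenvalue a3)).
  by apply: cvgM; apply: cvg_eigenvalue.
(* The denominator is now [e], and [a1 = 0] or [a2 = 0] supplies a factor [e] in the numerator to
   cancel it. *)
rewrite invr0 !mulr0 subr0 mul1r add0r.
have [-> _|a1_neq0] := eqVneq a1 0.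
  rewrite !mul0r subr0 mul1r add0r.
  apply: cvg_trans (@cvg_eigenvalue a2); apply: near_eq_cvg.
  apply: filterS (nbhs_dnbhs_neq _) => e e0.
  by rewrite !mulr0 !addr0 mulrAC divff // mul1r.
case=> // [a1_0|->]; first by rewrite a1_0 eqxx in a1_neq0.
rewrite mul0r subr0 mulr0 mulr1 addr0.
apply: cvg_trans (@cvg_eigenvalue a1); apply: near_eq_cvg.
apply: filterS (nbhs_dnbhs_neq _) => e e0.
by rewrite !mulr0 !addr0 -mulrA divff // mulr1.
Qed.

Lemma scaled_eigenvalue_neq0 a :
  \forall e \near (0 : K)^', e * w a e != 0.
Proof.
near=> e; rewrite mulf_neq0 //; last by near: e; apply: eigenvalue_neq0.
by near: e; apply: nbhs_dnbhs_neq.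
Unshelve. all: by end_near. Qed.

(** After one cancellation the quotient is [e / w a3 e] times [w a1 e * w a2 e], and both factors
    converge whatever the eigenvalues. *)
Lemma cvg_anti_IW_factor a1 a2 a3 :
  (e * w a1 e) * (e * w a2 e) / (e * w a3 e) @[e --> (0 : K)^'] -->
  (1 - a3 / a3) * (a1 * a2).
Proof.
apply: (cvg_trans _ (cvgM (@cvg_div_eigenvalue a3)
  (cvgM (@cvg_eigenvalue a1) (@cvg_eigenvalue a2)))).
apply: near_eq_cvg; near=> e => /=.
have e0 : e != 0 by near: e; apply: nbhs_dnbhs_neq.
have wa3_neq0 : w a3 e != 0 by near: e; apply: eigenvalue_neq0.
by field; rewrite e0 wa3_neq0.
Unshelve. all: by end_near. Qed.

End Eigenvalue.

(** * Convergence of both contractions *)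

Section DiagonalContractions.
Variables (R : realType) (V : vectType (Cplx R)) (g1 : lieAlgebra V).
Variables (b : (\dim {:V}).-tuple V) (d : 'rV[Cplx R]_(\dim {:V})).
Hypothesis bB : basis_of {:V} b.

Local Notation u := (hommx b b (diag_mx d)).

Lemma IW_contraction (subalg : lie_subalgebra g1 (V_R u)) :
  lie_contraction g1 (U_IW u)
    (IW_algebra (diag_uvu d bB) (diag_vuv d bB) (diag_uv d bB) subalg).
Proof.
apply: (lie_contraction_diagonal bB (w := fun i e => e + (1 - e) * d 0 i)).
- exact: U_IW_diag.
- by move=> i; apply: eigenvalue_neq0.
move=> i j k; rewrite [X in _ --> X]coord_IW_bracket //.
(* Zero structure constants are treated first, since their factor may diverge; for the others
   [structure_constant_eq0] provides the condition of [cvg_IW_factor]. *)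
have [c0|c_neq0] := eqVneq (coord b k (g1 b`_i b`_j)) 0.
  by rewrite c0 mul0r; under eq_fun do rewrite mul0r; exact: cvg_cst.
apply: cvgMl_tmp; apply: cvg_IW_factor.
have [|di0] := eqVneq (d 0 i) 0; first by constructor 1.
have [|dj0] := eqVneq (d 0 j) 0; first by constructor 2.
constructor 3; apply: contraNneq c_neq0 => dk0.
by rewrite (structure_constant_eq0 bB subalg).
Qed.

Lemma anti_IW_contraction :
  lie_contraction g1 (U_anti_IW u)
    (anti_IW_algebra g1 (diag_uvu d bB) (diag_uv d bB)).
Proof.
apply: (lie_contraction_diagonal bB
  (w := fun i e => e * (e + (1 - e) * d 0 i))).
- exact: U_anti_IW_diag.
- by move=> i; apply: scaled_eigenvalue_neq0.
move=> i j k; rewrite [X in _ --> X]coord_anti_IW_bracket //.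
by apply: cvgMl_tmp; apply: cvg_anti_IW_factor.
Qed.

End DiagonalContractions.

Theorem theorem4p4 (R : realType) (V : vectType (Cplx R)) (g1 : lieAlgebra V)
    (h frak_u : {vspace V})
    (h_subalg : lie_subalgebra g1 h) (u_sub_h : (frak_u <= h)%VS) :
  (lie_subalgebra g1 frak_u ->
    (exists u : 'End(V), diagonal_in_some_basis u /\ V_R u = frak_u) /\
    (forall u : 'End(V), diagonal_in_some_basis u -> V_R u = frak_u ->
      exists g0 : lieAlgebra V,
        lie_contraction g1 (U_IW u) g0 /\ semidirect_sum g0 (V_R u) (V_N u)))
  /\
  ((exists u : 'End(V), diagonal_in_some_basis u /\ V_N u = frak_u) /\
   (forall u : 'End(V), diagonal_in_some_basis u -> V_N u = frak_u ->
      exists g0 : lieAlgebra V,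
        lie_contraction g1 (U_anti_IW u) g0 /\ lie_nilpotent g0)).
Proof.
split=> [u_subalg|]; split; first exact: exists_diagonal_V_R.
- move=> u [b [d [bB uE]]] VRu; rewrite {}uE in VRu *.
  rewrite -VRu in u_subalg.
  eexists; split; first exact: (IW_contraction bB u_subalg).
  exact: IW_semidirect.
- exact: exists_diagonal_V_N.
- move=> u [b [d [bB ->]]] _.
  eexists; split; first exact: (anti_IW_contraction g1 d bB).
  exact: anti_IW_nilpotent.
Qed.
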